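(* For every constant $C\ge 1$ there is a constant $c>0$ such that the following holds. For every number of cups $n$ and every $k$ with $1\le k\le Cn$, if the emptier follows the greedy emptying strategy in the variable-processor cup game on $n$ cups (starting from all fills $0$), then no filler can achieve backlog $k$ within fewer than $c\left(k + \frac{k^3}{\log^2 (n/k+2)}\right)$ rounds.
   Context: The (standard) variable-processor cup game on $n$ cups: there are $n$ cups with real fills $x_1,\dots,x_n$, all initially $0$, and two adaptive players, a filler and an emptier. In each round the filler chooses an integer $1\le p\le n$ and reals $a_1,\dots,a_n\in[0,1]$ with $\sum_i a_i = p$, and replaces each $x_i$ by $x_i+a_i$; then the emptier chooses a set $S$ of exactly $p$ cups and replaces $x_i$ by $\max(0,x_i-1)$ for each $i\in S$. The backlog of a state is $\max_i x_i$. The greedy emptier, in each round, chooses $S$ to be $p$ cups with the largest fills (after the filler's move), ties broken arbitrarily. *)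

(* Defs.v *)
From HB Require Import structures.
From mathcomp Require Import all_boot all_order all_algebra.
From mathcomp Require Import reals exp.
Set Implicit Arguments. Unset Strict Implicit. Unset Printing Implicit Defensive.
Import Order.TTheory GRing.Theory Num.Theory.
Local Open Scope ring_scope.

(* One round: from fills [x], the filler chooses p (1 <= p <= n) and
   a : 'I_n -> R with a i in [0,1] and sum a = p; then the emptier chooses
   the set S of exactly p cups, which must be p cups of largest fill after
   the filler's move (greedy, ties arbitrary); the new fills are [x']. *)
Definition greedy_round (R : realType) (n : nat) (x : 'I_n -> R) (p : nat)
    (a : 'I_n -> R) (S : {set 'I_n}) (x' : 'I_n -> R) : Prop :=
  [/\ (1 <= p <= n)%N,
      (forall i, 0 <= a i <= 1),
      \sum_(i < n) a i = p%:R,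
      #|S| = p
    & (forall i j, i \in S -> j \notin S -> x j + a j <= x i + a i)] /\
  (forall i, x' i = if i \in S then Num.max 0 (x i + a i - 1)
                        else x i + a i).

(* Backlog = maximum fill (fills are nonnegative, so 0 is a neutral start). *)
Definition backlog (R : realType) (n : nat) (x : 'I_n -> R) : R :=
  \big[Num.max/0]_(i < n) x i.

(* Main.v *)
Require Import Defs.
From HB Require Import structures.
From mathcomp Require Import all_boot all_order all_algebra.
From mathcomp Require Import reals exp.
From mathcomp Require Import zify ring lra.
Import Order.TTheory GRing.Theory Num.Theory.
Local Open Scope ring_scope.

(* For a level [h], let [E_h] be the total fill above [h]. In one greedy round
   at most one integer level has its excess increased, and an increase at [h]
   leaves [E_(h-1) - 2 E_h + E_(h+1) >= 1]. Hence the running maxima [M_h] evolve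
   by toppling: one site per round, each move keeping the profile convex, with
   second difference at least 1 wherever [M_h > 0].

   Toppling a site by [g] dissipates at least [2 g^2] of the Dirichlet energy
   [sum_h (M_h - M_(h+1))^2]. Localising this energy and using Cauchy-Schwarz, a
   window of [3 l] levels starting at [a] is toppled at least
   [l^3 (M_(a+3l) / M_a)^2] times. Strict convexity forces [M_h >= c k^2] for
   [h <= k/4], while [M_0 <= n k]; so over about [ln (n/k + 2)] windows of length
   about [k / ln (n/k + 2)] the ratios multiply to at least [c k / n], and
   [z^2 >= 1 + 2 ln z] shows that typical windows need order [l^3] topplings. *)
Definition excess (R : realType) (n : nat) (x : 'I_n -> R) (h : nat) : R :=
  \sum_(i < n) Num.max 0 (x i - h%:R).

Arguments excess {R n}.

Ltac case_max0 := repeat match goal with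
  |- context [Order.max 0 ?y] =>
    lazymatch y with
    | context [Order.max 0 _] => fail
    | _ => case: (leP 0 y) => ?
    end
  end.

(** * Excess above a level in one greedy round *)

Section Excess.
Context {R : realType} {n : nat}.
Implicit Type x : 'I_n -> R.

Lemma excessS x h : excess x h.+1 <= excess x h.
Proof.
apply: ler_sum => i _; rewrite -natr1.
by case_max0; lra.
Qed.

Lemma excess_gt0 x h i : h%:R < x i -> 0 < excess x h.
Proof.
move=> hx; rewrite /excess (bigD1 i) //= ltr_wpDr //.
  by apply: sumr_ge0 => j _; rewrite le_max lexx.
by rewrite lt_max subr_gt0 hx orbT.
Qed.

Lemma excess_eq0 x h : (forall i, x i <= h%:R) -> excess x h = 0.
Proof.
move=> xh; apply: big1 => i _; have := xh i.
by case_max0; lra.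
Qed.

Section Round.
Context {x a x' : 'I_n -> R} {p : nat} {S : {set 'I_n}}.
Hypothesis x_ge0 : forall i, 0 <= x i.
Hypothesis xx' : greedy_round x p a S x'.

Lemma round_ge0 i : 0 <= x' i.
Proof.
case: xx' => -[_ a01 _ _ _] ->; have /andP[a0 _] := a01 i.
by case: ifP => _; rewrite ?le_max ?lexx // addr_ge0.
Qed.

Lemma round_le i : x' i <= x i + 1.
Proof.
case: xx' => -[_ a01 _ _ _] ->; have := a01 i; have := x_ge0 i.
by case: ifP => _; case_max0; lra.
Qed.

(** An emptied cup never gains excess, and another cup can do so only if its new fill exceeds
    [h]. *)
Lemma excess_incr_above h : excess x h < excess x' h ->
  exists2 j, j \notin S & h%:R < x j + a j.
Proof.
move=> hlt; apply/exists_inP; apply: contraLR hlt => /exists_inPn noj.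
rewrite -leNgt; apply: ler_sum => i _; case: xx' => -[_ a01 _ _ _] ->.
have h0 : 0 <= h%:R :> R by [].
have := a01 i; have := x_ge0 i; case: ifPn => [_|iS].
  by case_max0; lra.
have := noj i iS; rewrite -leNgt.
by case_max0; lra.
Qed.

(** If every emptied cup stood at [h + 1] or more, cup [i] would gain at most [a i - (i \in S)], and
    these sum to [p - p]. *)
Lemma excess_incr_below h : excess x h < excess x' h ->
  exists2 i, i \in S & x i + a i < h%:R + 1.
Proof.
move=> hlt; apply/exists_inP; apply: contraLR hlt => /exists_inPn noi.
rewrite -leNgt; case: xx' => -[_ a01 suma cardS _] x'E.
have h0 : 0 <= h%:R :> R by [].
have -> : excess x h = excess x h + \sum_i (a i - (i \in S)%:R).
  rewrite sumrB suma -natr_sum.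
  have -> : (\sum_(i < n) (i \in S) = p)%N.
    by rewrite -cardS -sum1_card [RHS]big_mkcond.
  by rewrite subrr addr0.
rewrite -big_split; apply: ler_sum => i _ /=; rewrite x'E.
have := a01 i; have := x_ge0 i; case: (boolP (i \in S)) => [iS|_].
  have := noi i iS; rewrite -leNgt mulr1n => ?.
  by case_max0; lra.
by rewrite mulr0n; case_max0; lra.
Qed.

Lemma excess_incr_uniq h h' :
  excess x h < excess x' h -> excess x h' < excess x' h' ->
  h = h'.
Proof.
(* Greediness gives [m' < x j + a j <= x i + a i < m + 1]. *)
have aux m m' : excess x m < excess x' m ->
    excess x m' < excess x' m' -> (m' <= m)%N.
  move=> /excess_incr_below[i iS ilt] /excess_incr_above[j jS jgt].
  case: xx' => -[_ _ _ _ greedy] _; have := greedy _ _ iS jS => ij.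
  by rewrite -ltnS -(ltr_nat R) -natr1; lra.
by move=> hlt h'lt; apply/eqP; rewrite eqn_leq !aux.
Qed.

(* The second difference of [excess] in the level is a sum of tent functions
   centred at [h.+1]; a cup left above and a cup emptied below this level are
   at distance at most 1, so their two tents already sum to at least 1. *)
Lemma excess_incr_convex h : excess x h.+1 < excess x' h.+1 ->
  2 * excess x' h.+1 + 1 <= excess x' h + excess x' h.+2.
Proof.
move=> hlt; have [i iS ilt] := excess_incr_below _ hlt.
have [j jS jgt] := excess_incr_above _ hlt.
case: xx' => -[_ _ _ _ greedy] x'E; have ij := greedy _ _ iS jS.
pose tent y : R := Num.max 0 (y - h%:R) + Num.max 0 (y - h.+2%:R)
                   - 2 * Num.max 0 (y - h.+1%:R).
have hS : h.+1%:R = h%:R + 1 :> R by rewrite natr1.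
have hSS : h.+2%:R = h%:R + 2 :> R by rewrite -addn2 natrD.
have h0 : 0 <= h%:R :> R by [].
have tent_ge0 y : 0 <= tent y.
  rewrite /tent hS hSS; by case_max0; lra.
have tent_left y : y <= h.+1%:R -> y - h%:R <= tent y.
  by rewrite /tent hS hSS => ?; case_max0; lra.
have tent_right y : h.+1%:R <= y -> h.+2%:R - y <= tent y.
  by rewrite /tent hS hSS => ?; case_max0; lra.
suff : 1 <= \sum_i tent (x' i).
  by rewrite sumrB big_split /= -mulr_sumr /excess; lra.
have jNi : j != i by apply: contraNneq jS => ->.
rewrite (bigD1 i) //= (bigD1 j) //= addrA ler_wpDr ?sumr_ge0 //.
have x'j : x' j = x j + a j by rewrite x'E (negPf jS).
have x'i : x i + a i - 1 <= x' i <= h.+1%:R.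
  by rewrite x'E iS hS; rewrite hS in ilt; case_max0; lra.
have := tent_left (x' i); have := tent_right (x' j); lra.
Qed.

End Round.
End Excess.

(** * Toppling processes and their convex profiles *)

(** Models the running maxima of the excess. At an idle step [v t] is arbitrary; level 0 is a
    boundary, free of the convexity condition. *)
Record toppling (R : realType) (M : nat -> nat -> R) (v : nat -> nat)
    (H : nat) : Prop := Toppling {
  topple0 : forall h, M 0%N h = 0;
  topple_incr : forall t h, M t h <= M t.+1 h;
  topple_site : forall t h, h != v t -> M t.+1 h = M t h;
  topple_convex : forall t h, M t h.+1 < M t.+1 h.+1 ->
    2 * M t.+1 h.+1 + 1 <= M t h + M t h.+2;
  topple_decr : forall t h, M t h.+1 <= M t h;
  topple_supp : forall t h, (H <= h)%N -> M t h = 0 }.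

Arguments toppling {R}.
Arguments topple0 {R M v H}.
Arguments topple_incr {R M v H}.
Arguments topple_site {R M v H}.
Arguments topple_convex {R M v H}.
Arguments topple_decr {R M v H}.
Arguments topple_supp {R M v H}.

Lemma sum_indicator (b c H : nat) :
  (\sum_(0 <= h < H) (b <= h < c) = minn c H - minn b H)%N.
Proof.
elim: H => [|H IH]; first by rewrite big_geq //; lia.
by rewrite big_nat_recr //= IH; case: (leqP b H); case: (ltnP H c) => /=; lia.
Qed.

Lemma sum_two_terms (V : zmodType) (f : nat -> V) (w H : nat) :
  (w.+1 < H)%N -> (forall h, h != w -> h != w.+1 -> f h = 0) ->
  \sum_(0 <= h < H) f h = f w + f w.+1.
Proof.
move=> wH f0; rewrite (big_cat_nat (n := w)) //=; last by lia.
rewrite big_nat big1 ?add0r => [|h hw]; last by apply: f0; lia.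
rewrite big_ltn; last by lia.
rewrite big_ltn // big_nat big1 ?addr0 // => h hw.
by apply: f0; lia.
Qed.

Section Toppling.
Context {R : realType} {M : nat -> nat -> R} {v : nat -> nat} {H : nat}.
Hypothesis tM : toppling M v H.

Lemma topple_le s t h : (s <= t)%N -> M s h <= M t h.
Proof.
move=> /subnKC <-; elim: (t - s)%N => [|d IH]; first by rewrite addn0.
by rewrite addnS (le_trans IH) // (topple_incr tM).
Qed.

Lemma topple_ge0 t h : 0 <= M t h.
Proof. by rewrite -(topple0 tM h) topple_le. Qed.

Lemma topple_anti t b c : (b <= c)%N -> M t c <= M t b.
Proof.
move=> /subnKC <-; elim: (c - b)%N => [|d IH]; first by rewrite addn0.
by rewrite addnS (le_trans _ IH) // (topple_decr tM).
Qed.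

(** The inequality holds when level [h.+1] last rises, and afterwards its neighbours can only
    rise. *)
Lemma topple_strict_convex t h : 0 < M t h.+1 ->
  2 * M t h.+1 + 1 <= M t h + M t h.+2.
Proof.
elim: t => [|t IH]; first by rewrite !(topple0 tM) ltxx.
have := topple_incr tM t h; have := topple_incr tM t h.+2.
have := topple_incr tM t h.+1; rewrite le_eqVlt => /predU1P[<-|lt2].
  by move=> ? ? /IH; lra.
by have := topple_convex tM t h lt2; lra.
Qed.

Definition slope t h := M t h - M t h.+1.

Lemma slope_ge0 t h : 0 <= slope t h.
Proof. by rewrite subr_ge0 (topple_decr tM). Qed.

Lemma slopeS t h : slope t h.+1 <= slope t h.
Proof.
rewrite /slope; have := topple_ge0 t h.+1; rewrite le_eqVlt => /predU1P[M0|].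
  have := topple_ge0 t h; have := topple_ge0 t h.+2; lra.
by move/topple_strict_convex; lra.
Qed.

Lemma slope_anti t b c : (b <= c)%N -> slope t c <= slope t b.
Proof.
move=> /subnKC <-; elim: (c - b)%N => [|d IH]; first by rewrite addn0.
by rewrite addnS (le_trans _ IH) // slopeS.
Qed.

(** Slopes decrease with the level, so each of the [l] drops from [a] to [a + l] is at least
    [slope t h]. *)
Lemma slope_chord t a l h : (a + l <= h)%N -> l%:R * slope t h <= M t a.
Proof.
move=> alh; suff: l%:R * slope t h <= M t a - M t (a + l)%N.
  by have := topple_ge0 t (a + l)%N; lra.
elim: l alh => [|l IH] alh; first by rewrite addn0 mul0r subrr.
have := IH ltac:(lia); rewrite addnS -natr1.
have : slope t h <= slope t (a + l)%N by apply: slope_anti; lia.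
rewrite {2}/slope; lra.
Qed.

Lemma topple_quadratic t m j : (j <= m)%N -> 0 < M t m ->
  j%:R ^+ 2 / 2 <= M t (m - j)%N.
Proof.
move=> jm Mm.
(* Going down from [m], each level adds at least 1 to the slope; summing the slopes gives the
   square. *)
suff [] : j%:R ^+ 2 / 2 <= M t (m - j)%N /\ j%:R <= slope t (m - j)%N by [].
elim: j jm => [|j IH] jm.
  by rewrite subn0 expr0n /= mul0r slope_ge0 ltW.
have [IH1 IH2] := IH ltac:(lia).
have E : (m - j = (m - j.+1).+1)%N by lia.
rewrite E in IH1 IH2; rewrite -natr1.
have Mpos : 0 < M t (m - j.+1).+1.
  by rewrite (lt_le_trans Mm) // topple_anti //; lia.
have := topple_strict_convex _ _ Mpos; rewrite /slope in IH2 * => ?.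
have j0 : 0 <= j%:R :> R by [].
split; last by lra.
nra.
Qed.

(** * Localised energy of one window *)

Section Window.
Variables (a l T : nat) (lam : R).
Hypothesis l_gt0 : (0 < l)%N.

(** The first third of the window only serves to bound the slope; the weight climbs from 0 to [l] on
    the second third and stays at [l] beyond. *)
Let weight h := minn l (h - (a + l)).
Let ramp h := (a + l <= h < a + 2 * l)%N.
Let plateau h := (a + 2 * l <= h < a + 3 * l)%N.
(** Index [h] stands for the edge from [h] to [h.+1]. The linear summands credit a rise of level
    [h.+1] on the plateau and charge one on the ramp. *)
Let term t h := (weight h)%:R * slope t h ^+ 2
  + (plateau h)%:R * (4 * lam * l%:R * M t h.+1)
  - (ramp h)%:R * (2 * M T a / l%:R * M t h.+1).
Let visits t := (\sum_(0 <= s < t) (a + 2 * l < v s <= a + 3 * l))%N.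

(* Weighted Dirichlet energy: toppling [w.+1] by [g] moves [g] from the slope
   at [w] to the slope at [w.+1], which dissipates at least [2 g^2] per unit of
   weight; energy enters only through the ramp, where the slope is at most
   [M T a / l]. On the plateau, [4 lam g - 2 lam^2 <= 2 g^2] turns dissipation
   into a count of steps. *)
Lemma energy_step t : (t < T)%N ->
  \sum_(0 <= h < H) (term t.+1 h - term t h)
    <= 2 * l%:R * lam ^+ 2 * (a + 2 * l < v t <= a + 3 * l)%N%:R.
Proof.
move=> tT; have rhs0 : 0 <= 2 * l%:R * lam ^+ 2 *
    (a + 2 * l < v t <= a + 3 * l)%N%:R.
  by rewrite mulr_ge0 // mulr_ge0 ?sqr_ge0 // mulr_ge0.
have [Hv|vH] := leqP H (v t).
  rewrite big1_seq // => h _.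
  have ME h' : M t.+1 h' = M t h'.
    have [->|] := eqVneq h' (v t); last exact: topple_site tM _ _.
    by rewrite !(topple_supp tM).
  by rewrite /term /slope !ME subrr.
(* Level 0 meets only edge 0, whose weight is 0. *)
case vE : (v t) => [|w] in vH rhs0 *.
  rewrite big1_seq // => h _.
  have ME h' : h' != 0%N -> M t.+1 h' = M t h'.
    by move=> ?; apply: (topple_site tM); rewrite vE.
  rewrite /term /slope !(ME h.+1) //; case: h => [|h].
    by rewrite (_ : weight 0 = 0%N) /weight; [rewrite !mul0r subrr | lia].
  by rewrite (ME h.+1) // subrr.
have ME h : h != w.+1 -> M t.+1 h = M t h.
  by move=> ?; apply: (topple_site tM); rewrite vE.
set g := M t.+1 w.+1 - M t w.+1.
have ME1 : M t.+1 w.+1 = M t w.+1 + g by rewrite /g; lra.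
have g0 : 0 <= g by rewrite subr_ge0 (topple_incr tM).
have gm : 2 * g <= slope t w - slope t w.+1.
  have : 0 <= g by []; rewrite le_eqVlt => /predU1P[<-|].
    by rewrite mulr0 subr_ge0 slopeS.
  rewrite subr_gt0 => /(topple_convex tM); rewrite ME1 /slope; lra.
clearbody g; have s0 := slope_ge0 t w.+1.
rewrite (sum_two_terms _ _ w) //; last first.
  move=> h hw hw1; rewrite /term /slope !ME ?subrr //; lia.
have -> : term t.+1 w = (weight w)%:R * (slope t w - g) ^+ 2
  + (plateau w)%:R * (4 * lam * l%:R * (M t w.+1 + g))
  - (ramp w)%:R * (2 * M T a / l%:R * (M t w.+1 + g)).
  rewrite /term /slope ME1 (ME w); last by lia.
  by rewrite opprD addrA.
have -> : term t.+1 w.+1 = (weight w.+1)%:R * (slope t w.+1 + g) ^+ 2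
  + (plateau w.+1)%:R * (4 * lam * l%:R * M t w.+2)
  - (ramp w.+1)%:R * (2 * M T a / l%:R * M t w.+2).
  rewrite /term /slope ME1 (ME w.+2); last by lia.
  by rewrite (addrAC _ g).
have -> : (a + 2 * l < w.+1 <= a + 3 * l)%N = plateau w by [].
rewrite /term.
have l0 : 0 < l%:R :> R by rewrite ltr0n.
have [wl|lw] := ltnP w (a + l).
  have -> : weight w = 0%N by rewrite /weight; lia.
  have -> : weight w.+1 = 0%N by rewrite /weight; lia.
  have -> : ramp w = false by rewrite /ramp; lia.
  have -> : plateau w = false by rewrite /plateau; lia.
  rewrite !mulr0n; lra.
have sw : l%:R * slope t w <= M T a.
  by rewrite (le_trans (slope_chord t _ _ _ lw)) // topple_le // ltnW.
have [w2l|l2w] := ltnP w (a + 2 * l).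
  have -> : weight w.+1 = (weight w).+1 by rewrite /weight; lia.
  have -> : ramp w = true by rewrite /ramp; lia.
  have -> : plateau w = false by rewrite /plateau; lia.
  have sw' : slope t w <= M T a / l%:R by rewrite ler_pdivlMr // mulrC.
  have W0 : 0 <= (weight w)%:R :> R by [].
  rewrite -(natr1 (weight w)) -(mulrA 2 (M T a)); move: W0 sw' gm s0 g0.
  move: (weight w)%:R (M T a / l%:R) (slope t w) (slope t w.+1) => W B d e.
  move=> W0 dB gm e0 g0.
  (* The right edge weighs one unit more; the extra [g * (2 * e + g)] is at most [2 * g * d], which
     the ramp charge covers. *)
  have : 0 <= W * (g * (d - e - 2 * g)) by rewrite mulr_ge0 // mulr_ge0 ?subr_ge0.
  have : 0 <= g * (B - d) by rewrite mulr_ge0 ?subr_ge0.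
  have : 0 <= g * (d - e - 2 * g) by rewrite mulr_ge0 ?subr_ge0.
  have : 0 <= W * g ^+ 2 by rewrite mulr_ge0 ?sqr_ge0.
  have := sqr_ge0 g; rewrite mulr1n mulr0n; lra.
have -> : weight w.+1 = l by rewrite /weight; lia.
have -> : weight w = l by rewrite /weight; lia.
have -> : ramp w = false by rewrite /ramp; lia.
move: l0 gm s0 g0; move: l%:R (slope t w) (slope t w.+1) => W d e.
move=> W0 gm e0 g0.
have : 0 <= W * (g * (d - e - 2 * g))
  by rewrite mulr_ge0 ?(ltW W0) // mulr_ge0 ?subr_ge0.
have : 0 <= W * (g - lam) ^+ 2 by rewrite mulr_ge0 ?(ltW W0) ?sqr_ge0.
have : 0 <= W * g ^+ 2 by rewrite mulr_ge0 ?(ltW W0) ?sqr_ge0.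
by case: (plateau w); rewrite ?mulr1n ?mulr0n; lra.
Qed.

Lemma energy_bound t : (t <= T)%N ->
  \sum_(0 <= h < H) term t h <= 2 * l%:R * lam ^+ 2 * (visits t)%:R.
Proof.
elim: t => [|t IH] tT.
  rewrite /visits big_geq // mulr0 big1_seq // => h _.
  by rewrite /term /slope !(topple0 tM) subrr expr0n /= !mulr0 subr0 addr0.
have := energy_step _ tT; rewrite sumrB; have := IH (ltnW tT).
rewrite /visits big_nat_recr //= natrD; lra.
Qed.

End Window.

(** Dropping the squares from the energy at time [T] leaves at least [4 lam l^2 B - 2 A^2], where
    [A] and [B] are the values at the two ends of the window. *)
Lemma window_visits (a l T : nat) : (0 < l)%N -> 0 < M T (a + 3 * l)%N ->
  l%:R ^+ 3 * (M T (a + 3 * l)%N / M T a) ^+ 2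
  <= (\sum_(0 <= s < T) (a + 2 * l < v s <= a + 3 * l))%N%:R.
Proof.
move=> l0; set B := M T _ => B0; set A := M T a.
have AB : B <= A by apply: topple_anti; lia.
have A0 : 0 < A by apply: lt_le_trans AB.
have lR : 0 < l%:R :> R by rewrite ltr0n.
have alH : (a + 3 * l <= H)%N.
  rewrite leqNgt; apply/negP => /ltnW Hal.
  by move: B0; rewrite /B (topple_supp tM) ?ltxx.
(* This value maximises the resulting lower bound [(2 lam l^2 B - A^2) / (l lam^2)] on the
   visits. *)
pose lam := A ^+ 2 / (l%:R ^+ 2 * B).
have lam0 : 0 <= lam by rewrite divr_ge0 ?sqr_ge0 // mulr_ge0 ?sqr_ge0 // ltW.
have := energy_bound a l T lam l0 T (leqnn T).
set N := (\sum_(0 <= s < T) _)%N => le.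
have {le} : 4 * lam * l%:R * B * l%:R - 2 * A / l%:R * A * l%:R <=
    2 * l%:R * lam ^+ 2 * N%:R.
  apply: le_trans le.
  have E1 : l%:R = \sum_(0 <= h < H) (a + 2 * l <= h < a + 3 * l)%N%:R :> R.
    by rewrite -natr_sum sum_indicator; congr (_%:R); lia.
  have E2 : l%:R = \sum_(0 <= h < H) (a + l <= h < a + 2 * l)%N%:R :> R.
    by rewrite -natr_sum sum_indicator; congr (_%:R); lia.
  have -> : 4 * lam * l%:R * B * l%:R - 2 * A / l%:R * A * l%:R =
      \sum_(0 <= h < H)
        ((a + 2 * l <= h < a + 3 * l)%N%:R * (4 * lam * l%:R * B) -
         (a + l <= h < a + 2 * l)%N%:R * (2 * A / l%:R * A)).
    by rewrite sumrB -!mulr_suml -E1 -E2; ring.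
  apply: ler_sum => h _.
  have : 0 <= (minn l (h - (a + l)))%:R * slope T h ^+ 2.
    by rewrite mulr_ge0 ?sqr_ge0.
  have lA : 0 <= 2 * A / l%:R by rewrite divr_ge0 ?mulr_ge0 // ltW.
  have lB : 0 <= 4 * lam * l%:R by rewrite mulr_ge0 // mulr_ge0.
  case: (boolP (a + 2 * l <= h < a + 3 * l)%N) => hp;
    case: (boolP (a + l <= h < a + 2 * l)%N) => hr; rewrite ?mulr1n ?mulr0n.
  - by lia.
  - have : B <= M T h.+1 by apply: topple_anti; lia.
    by move=> /(ler_wpM2l lB); lra.
  - have : M T h.+1 <= A by apply: topple_anti; lia.
    by move=> /(ler_wpM2l lA); rewrite /A; lra.
  - by lra.
have -> : 4 * lam * l%:R * B * l%:R - 2 * A / l%:R * A * l%:R = 2 * A ^+ 2.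
  by rewrite /lam; field; rewrite !gt_eqF.
have -> : 2 * l%:R * lam ^+ 2 * N%:R
    = 2 * A ^+ 2 * (N%:R * A ^+ 2 / (l%:R ^+ 3 * B ^+ 2)).
  by rewrite /lam; field; rewrite !gt_eqF.
rewrite -[leLHS]mulr1 ler_pM2l; last by rewrite mulr_gt0 // exprn_gt0.
rewrite ler_pdivlMr ?mul1r; last by rewrite mulr_gt0 // exprn_gt0.
by move=> le; rewrite expr_div_n mulrA ler_pdivrMr // exprn_gt0.
Qed.

End Toppling.

(** * Chaining consecutive windows *)

Lemma le_1Dln_sqr (R : realType) (z : R) : 0 < z -> 1 + 2 * ln z <= z ^+ 2.
Proof.
move=> z0; have z20 : 0 < z ^+ 2 by rewrite exprn_gt0.
have := @le_ln1Dx R (z ^+ 2 - 1) ltac:(lra).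
by rewrite addrC subrK lnXn // -mulr_natl; lra.
Qed.

(** The counted thirds of successive windows are disjoint, and the logarithms of the ratios
    telescope. *)
Lemma toppling_visits (R : realType) (M : nat -> nat -> R) v H T l J :
  toppling M v H -> (0 < l)%N -> 0 < M T (3 * l * J)%N ->
  l%:R ^+ 3 * (J%:R + 2 * ln (M T (3 * l * J)%N / M T 0%N)) <=
  (\sum_(0 <= s < T) (v s <= 3 * l * J))%N%:R.
Proof.
move=> tM l0; elim: J => [|J IH] MJ.
  rewrite muln0 in MJ *.
  by rewrite divff ?gt_eqF // ln1 mulr0 addr0 mulr0.
have EJ : (3 * l * J.+1 = 3 * l * J + 3 * l)%N by rewrite mulnS addnC.
rewrite EJ in MJ *.
have MJ' : 0 < M T (3 * l * J)%N.
  by apply: (lt_le_trans MJ); apply: (topple_anti tM); lia.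
have M0 : 0 < M T 0%N by apply: (lt_le_trans MJ); apply: (topple_anti tM).
have := window_visits tM _ _ _ l0 MJ; have := IH MJ'.
set A := M T (3 * l * J)%N in MJ' *; set B := M T (_ + _)%N in MJ *.
have := le_1Dln_sqr R (B / A) ltac:(by rewrite divr_gt0).
rewrite !ln_div ?posrE // => lnz hA hB.
have : l%:R ^+ 3 * (1 + 2 * (ln B - ln A)) <= l%:R ^+ 3 * (B / A) ^+ 2.
  by rewrite ler_wpM2l // exprn_ge0.
have : (\sum_(0 <= s < T) (v s <= 3 * l * J) +
    \sum_(0 <= s < T) (3 * l * J + 2 * l < v s <= 3 * l * J + 3 * l) <=
    \sum_(0 <= s < T) (v s <= 3 * l * J + 3 * l))%N.
  by rewrite -big_split; apply: leq_sum => s _ /=; lia.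
by rewrite -(ler_nat R) natrD -(natr1 J); lra.
Qed.

Lemma toppling_time (R : realType) (M : nat -> nat -> R) v H T l J :
  toppling M v H -> (0 < l)%N -> 0 < M T (3 * l * J)%N ->
  l%:R ^+ 3 * (J%:R + 2 * ln (M T (3 * l * J)%N / M T 0%N)) <= T%:R.
Proof.
move=> tM l0 MJ; apply: (le_trans (toppling_visits _ _ _ _ _ _ _ tM l0 MJ)).
rewrite ler_nat -[leqRHS]subn0 -[leqRHS]muln1 -sum_nat_const_nat.
by apply: leq_sum => s _; apply: leq_b1.
Qed.

(** * Running maxima as a toppling process *)

Section Record.
Context {R : realType}.
Variable e : nat -> nat -> R.

Fixpoint record t h :=
  if t is s.+1 then Num.max (record s h) (e t h) else e 0%N h.

Lemma le_record t h : e t h <= record t h.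
Proof. by case: t => [|t] //=; rewrite le_max lexx orbT. Qed.

Lemma record_le t h (c : R) :
  (forall s, (s <= t)%N -> e s h <= c) -> record t h <= c.
Proof.
elim: t => [|t IH] ec /=; first exact: ec.
by rewrite ge_max IH ?ec // => s st; apply/ec/leqW.
Qed.

Lemma record_incr t h : record t h < record t.+1 h ->
  record t.+1 h = e t.+1 h /\ e t h < e t.+1 h.
Proof.
rewrite /= lt_max ltxx /= => lt; split; first by rewrite max_r // ltW.
exact: le_lt_trans (le_record t h) lt.
Qed.

Lemma record_toppling H :
  (forall h, e 0%N h = 0) ->
  (forall t h, e t h.+1 <= e t h) ->
  (forall t h, (H <= h)%N -> e t h = 0) ->
  (forall t h h', e t h < e t.+1 h -> e t h' < e t.+1 h' -> h = h') ->
  (forall t h, e t h.+1 < e t.+1 h.+1 ->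
     2 * e t.+1 h.+1 + 1 <= e t.+1 h + e t.+1 h.+2) ->
  exists v, toppling record v H.
Proof.
move=> e0 eS eH euniq econv.
have recH t h : (H <= h)%N -> record t h = 0.
  by move=> Hh; elim: t => [|t IH] /=; rewrite ?IH eH // maxxx.
(* [find] returns the level whose record rises, or [H] when there is none. *)
exists (fun t => find (fun h => record t h < record t.+1 h) (iota 0 H)); split.
- by [].
- by move=> t h; rewrite /= le_max lexx.
- move=> t h; apply: contraNeq => neq.
  have lt : record t h < record t.+1 h.
    by rewrite lt_neqAle eq_sym neq /= le_max lexx.
  have hH : (h < H)%N.
    by rewrite ltnNge; apply: contraTN lt => Hh; rewrite !recH // ltxx.
  set P := (P in find P _).
  have hasP : has P (iota 0 H) by apply/hasP; exists h => //; rewrite mem_iota.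
  have := nth_find 0%N hasP; rewrite nth_iota ?add0n; last first.
    by move: hasP; rewrite has_find size_iota.
  rewrite /P => /record_incr[_ lt1]; have [_ lt2] := record_incr _ _ lt.
  by apply/eqP; apply: euniq lt2 lt1.
- move=> t h /record_incr[-> lt]; have := econv _ _ lt.
  (* By uniqueness the neighbours do not rise at this step, so their values stay below the old
     records. *)
  have stay h' : h' != h.+1 -> e t.+1 h' <= record t h'.
    move=> /eqP neq; apply: le_trans (le_record t h').
    by rewrite leNgt; apply/negP => lt'; apply: neq; apply: euniq lt' lt.
  have := stay h ltac:(lia); have := stay h.+2 ltac:(lia); lra.
- move=> t h; elim: t => [|t IH] /=; first exact: eS.
  by rewrite ge_max !le_max IH eS orbT.
- exact: recH.
Qed.

End Record.

(** * From the game to toppling *)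

Section Game.
Context {R : realType} {n : nat}.
Variables (x : nat -> 'I_n -> R) (p : nat -> nat) (a : nat -> 'I_n -> R).
Variables (S : nat -> {set 'I_n}) (T : nat).
Hypothesis x0 : forall i, x 0%N i = 0.
Hypothesis rounds : forall t, (t < T)%N ->
  greedy_round (x t) (p t) (a t) (S t) (x t.+1).

Lemma fill_ge0 t i : (t <= T)%N -> 0 <= x t i.
Proof.
elim: t i => [|t IH] i tT; first by rewrite x0.
exact: round_ge0 (fun i => IH i (ltnW tT)) (rounds _ tT) i.
Qed.

Lemma fill_le_time t i : (t <= T)%N -> x t i <= t%:R.
Proof.
elim: t i => [|t IH] i tT; first by rewrite x0.
have := round_le (fun i => fill_ge0 t i (ltnW tT)) (rounds _ tT) i.
by have := IH i (ltnW tT); rewrite -natr1; lra.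
Qed.

(** A toppling process runs forever, so [minn t T] freezes the game after round [T]. *)
Lemma excess_toppling H : (forall t i, (t <= T)%N -> x t i <= H%:R) ->
  exists v, toppling (record (fun t => excess (x (minn t T)))) v H.
Proof.
move=> xH; have minS t : minn t T = minn t.+1 T \/ (t < T)%N by lia.
apply: record_toppling.
- by move=> h; rewrite min0n excess_eq0 // => i; rewrite x0.
- by move=> t h; apply: excessS.
- move=> t h Hh; apply: excess_eq0 => i; rewrite (le_trans (xH _ _ _)) ?ler_nat //.
  exact: geq_minr.
- move=> t h h'; have [->|tT] := minS t; first by rewrite ltxx.
  have -> : minn t T = t by lia.
  have -> : minn t.+1 T = t.+1 by lia.
  apply: excess_incr_uniq (rounds _ tT) _ _ => i; exact: fill_ge0 (ltnW tT).
- move=> t h; have [->|tT] := minS t; first by rewrite ltxx.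
  have -> : minn t T = t by lia.
  have -> : minn t.+1 T = t.+1 by lia.
  apply: excess_incr_convex (rounds _ tT) _ => i; exact: fill_ge0 (ltnW tT).
Qed.

Lemma excess_toppling_time (k : R) (m l J : nat) : 0 < k ->
  (forall t i, (t <= T)%N -> x t i < k) -> (exists i, m%:R < x T i) ->
  (0 < l)%N -> (6 * l * J <= m)%N -> k <= 2 * m%:R ->
  l%:R ^+ 3 * (J%:R - 12 * ln (n%:R / k + 2)) <= T%:R.
Proof.
move=> k0 xk [i xi] l0 lJm km.
have n0 : 0 < n%:R :> R by rewrite ltr0n (leq_ltn_trans _ (ltn_ord i)).
have [v tM] : exists v,
    toppling (record (fun t => excess (x (minn t T)))) v (Num.truncn k).+1.
  apply: excess_toppling => t j tT; apply/ltW/(lt_trans (xk _ _ tT)).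
  by have /andP[] := truncn_itv (ltW k0).
set M := record _ in tM.
have Mm : 0 < M T m.
  apply: lt_le_trans (le_record _ T m); rewrite minnn.
  exact: excess_gt0 xi.
have M0 : M T 0%N <= n%:R * k.
  apply: record_le => s sT.
  rewrite /excess; have -> : n%:R * k = \sum_(j < n) k.
    by rewrite sumr_const card_ord mulr_natl.
  apply: ler_sum => j _; rewrite subr0 ge_max (ltW k0) ltW // xk //.
  exact: geq_minr.
(* Level [3 l J] is at least [m / 2 >= k / 4] below [m], so quadratic growth gives
   [(k / 4)^2 / 2]. *)
have MJ : k ^+ 2 / 32 <= M T (3 * l * J)%N.
  have -> : (3 * l * J = m - (m - 3 * l * J))%N by lia.
  apply: le_trans (topple_quadratic tM _ _ _ _ Mm); last by lia.
  have : (m <= 2 * (m - 3 * l * J))%N by lia.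
  rewrite -(ler_nat R) natrM; move: (_ - _)%N%:R => j mj.
  have kj : k <= 4 * j by lra.
  have : k ^+ 2 <= (4 * j) ^+ 2 by rewrite ler_sqr // nnegrE; lra.
  by rewrite exprMn; lra.
have MJ0 : 0 < M T (3 * l * J)%N.
  by apply: lt_le_trans MJ; rewrite divr_gt0 // exprn_gt0.
have M00 : 0 < M T 0%N by apply: (lt_le_trans MJ0); apply: (topple_anti tM).
apply: le_trans (toppling_time _ _ _ _ _ _ _ tM l0 MJ0).
rewrite ler_wpM2l ?exprn_ge0 // lerD2l.
set r := n%:R / k; have r0 : 0 < r by rewrite divr_gt0.
(* The ratio is at least [1 / (32 r)], and [32 r <= 2^5 (r + 2) <= (r + 2)^6]. *)
suff : - ln ((r + 2) ^+ 6) <= ln (M T (3 * l * J)%N / M T 0%N).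
  by rewrite lnXn ?addr_gt0 // -mulr_natl; lra.
have r6 : 0 < (r + 2) ^+ 6 by rewrite exprn_gt0 // addr_gt0.
rewrite -lnV ?posrE // ler_ln ?posrE ?invr_gt0 ?divr_gt0 //.
rewrite ler_pdivlMr // mulrC ler_pdivrMr //.
apply: (le_trans M0).
have : k ^+ 2 / 32 * (r + 2) ^+ 6 <= M T (3 * l * J)%N * (r + 2) ^+ 6.
  by rewrite ler_wpM2r // ltW.
apply: le_trans.
have -> : n%:R * k = k ^+ 2 / 32 * (32 * r) by rewrite /r; field; rewrite gt_eqF.
rewrite ler_wpM2l ?divr_ge0 ?sqr_ge0 //.
have : 2 ^+ 5 <= (r + 2) ^+ 5 by rewrite lerXn2r ?nnegrE; lra.
by rewrite exprSr; nra.
Qed.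

End Game.

(** * Choice of scales and conclusion *)

Lemma ln2_ge_half (R : realType) : 2^-1 <= ln (2 : R).
Proof.
have := @le_ln1Dx R (- 2^-1) ltac:(lra).
have -> : 1 - 2^-1 = (2 : R)^-1 by lra.
rewrite lnV ?posrE //; lra.
Qed.

(** [J >= 24 L] outweighs the logarithmic loss [12 L]. As [L >= 1/2], [J] can be kept below [26 L];
    then [312 = 2 * 6 * 26] makes [l] positive, and [624 = 2 * 12 * 26]. *)
Lemma scale_choice (R : realType) (k L : R) : 2^-1 <= L -> 312 * L < k ->
  exists m l J : nat, [/\ m%:R < k - 1, k <= 2 * m%:R, (0 < l)%N,
    (6 * l * J <= m)%N & 24 * L <= J%:R /\ k <= 624 * L * l%:R].
Proof.
move=> L2 Lk.
have /andP[tk kt] := truncn_itv (ltac:(lra) : 0 <= k).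
have /andP[tJ Jt] := truncn_itv (ltac:(lra) : 0 <= 24 * L).
set m := (Num.truncn k - 2)%N; set J := (Num.truncn (24 * L)).+1.
have t2 : (2 <= Num.truncn k)%N.
  by rewrite -ltnS -(ltr_nat R); lra.
have mE : m%:R = (Num.truncn k)%:R - 2 :> R by rewrite natrB.
rewrite -natr1 in kt.
have J26 : J%:R <= 26 * L by rewrite /J -natr1; lra.
have km : k <= 2 * m%:R by rewrite mE; lra.
have Jm : (6 * J <= m)%N by rewrite -(ler_nat R) natrM; lra.
exists m, (m %/ (6 * J))%N, J; split => //.
- by rewrite mE; lra.
- by rewrite divn_gt0.
- by have := leq_divM m (6 * J); lia.
split; first exact: ltW.
have l0 : (0 < m %/ (6 * J))%N by rewrite divn_gt0.
have := ltn_ceil m (isT : (0 < 6 * J)%N).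
move: (m %/ _)%N l0 => l l0 lt.
(* Rounding [l] down costs at most a factor 2, since [l >= 1]. *)
have : (m <= 12 * l * J)%N by nia.
rewrite -(ler_nat R) !natrM => le.
have : 12 * l%:R * J%:R <= 12 * l%:R * (26 * L) by rewrite ler_wpM2l // mulr_ge0.
lra.
Qed.

Theorem theorem6p1 (R : realType) :
  forall C : R, 1 <= C ->
  exists c : R, 0 < c /\
  forall (n : nat) (k : R), 1 <= k -> k <= C * n%:R ->
  forall (x : nat -> 'I_n -> R) (p : nat -> nat) (a : nat -> 'I_n -> R)
         (S : nat -> {set 'I_n}) (T : nat),
    (forall i, x 0%N i = 0) ->
    (forall t, (t < T)%N -> greedy_round (x t) (p t) (a t) (S t) (x t.+1)) ->
    k <= backlog (x T) ->
    c * (k + k ^+ 3 / (ln (n%:R / k + 2)) ^+ 2) <= T%:R.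
Proof.
move=> C _; have K0 : 0 <= 624 ^+ 3 :> R by rewrite exprn_ge0.
(* The 1 pays for the linear term through [k <= T], and [624 ^+ 3] for the cubic one through
   [k <= 624 L l]. *)
exists (1 + 624 ^+ 3)^-1; split; first by rewrite invr_gt0; lra.
move=> n k k1 _ x p a S T x0 rounds.
have k0 : 0 < k by lra.
move=> /boolp.bigmax_geP[|[i _ xi]]; first by lra.
set L := ln _.
have L2 : 2^-1 <= L.
  rewrite (le_trans (ln2_ge_half R)) // ler_ln ?posrE ?ltr_wpDl ?lerDr //.
    by rewrite divr_ge0 // ltW.
  by rewrite divr_ge0 // ltW.
have L0 : 0 < L by lra.
rewrite ler_pdivrMl; last by lra.
have kT : k <= T%:R by rewrite (le_trans xi) // (fill_le_time x p a S T).
suff : k ^+ 3 / L ^+ 2 <= 624 ^+ 3 * T%:R by lra.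
(* When [k] is at most a multiple of [L], the linear bound [k <= T] already suffices. *)
have [kL|Lk] := leP k (312 * L).
  rewrite ler_pdivrMr ?exprn_gt0 // exprS.
  apply: (@le_trans _ _ (T%:R * (312 * L) ^+ 2)).
    by rewrite ler_pM ?sqr_ge0 ?lerXn2r ?nnegrE //; lra.
  rewrite exprMn mulrCA mulrA ler_wpM2r ?sqr_ge0 // ler_wpM2r //.
  apply: (@le_trans _ _ (624 ^+ 2)); first by rewrite lerXn2r ?nnegrE ?ler_nat.
  by rewrite ler_eXn2l // ltr1n.
(* Stop just before the backlog first reaches [k]: all fills are still below [k], and one round adds
   at most 1, so some fill is at least [k - 1]. *)
have [t [tT xt xk]] : exists t, [/\ (t < T)%N,
    forall s j, (s <= t)%N -> x s j < k & exists j, k - 1 <= x t j].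
  have hit : exists t, (t <= T)%N && [exists j, k <= x t j].
    by exists T; rewrite leqnn; apply/existsP; exists i.
  case: (ex_minnP hit) => -[|t] /andP[tT /existsP[j xj]] tmin.
    by move: xj; rewrite x0; lra.
  exists t; split => //.
    move=> s j' st; rewrite ltNge; apply/negP => xs.
    have : (t.+1 <= s)%N; last by rewrite ltnNge st.
    apply: tmin; rewrite (leq_trans st (ltnW tT)).
    by apply/existsP; exists j'.
  exists j; have xt0 i' := fill_ge0 x p a S T x0 rounds t i' (ltnW tT).
  by have := round_le xt0 (rounds _ tT) j; lra.
have [m [l [J [mk km l0 lJm [LJ kl]]]]] := scale_choice R k L L2 Lk.
have := excess_toppling_time x p a S t x0
  (fun s st => rounds s (ltn_trans st tT)) k m l J k0 xt.
move=> /(_ _ l0 lJm km); rewrite -/L => timet.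
have tTR : t%:R <= T%:R :> R by rewrite ler_nat ltnW.
have {timet} : l%:R ^+ 3 * (J%:R - 12 * L) <= T%:R.
  apply: le_trans tTR; apply: timet.
  by have [j xj] := xk; exists j; lra.
have l30 : 0 <= l%:R ^+ 3 :> R by rewrite exprn_ge0.
move=> timeT; rewrite ler_pdivrMr ?exprn_gt0 //.
have : k ^+ 3 <= (624 * L * l%:R) ^+ 3.
  by rewrite lerXn2r ?nnegrE // ltW // (lt_le_trans k0).
rewrite !exprMn => /le_trans; apply.
have -> : 624 ^+ 3 * L ^+ 3 * l%:R ^+ 3 = 624 ^+ 3 * (l%:R ^+ 3 * L) * L ^+ 2.
  by move: (624 ^+ 3) => K; ring.
rewrite ler_wpM2r ?sqr_ge0 // ler_wpM2l // (le_trans _ timeT) // ler_wpM2l //.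
lra.
Qed.
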